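(* Let $a,b_1,b_2\in\mathbb{Z}_n$ with $a\not\equiv 0,\,n/2\pmod n$ (the condition $a\not\equiv n/2$ being relevant only for even $n$), and let $S=\{r^{\pm a},\,sr^{b_1},\,sr^{b_2}\}\subseteq D_{2n}$. Let $T=\{\pm a\}\subset\mathbb{Z}_n$, let $M_{b_j}=\bigl\{\{r^i,\,sr^{b_j-i}\}: i\in\mathbb{Z}_n\bigr\}$ for $j\in\{1,2\}$, and let $\Gamma=\mathrm{Cay}(D_{2n},S)$. Then $V(\Gamma)=R_n\cup F_n$ and $$E(\Gamma)=E_{R}\cup E_{F}\cup M_{b_1}\cup M_{b_2},$$ where $E_R=\{\{r^i,r^{i+t}\}: i\in\mathbb{Z}_n,\ t\in T\}$ and $E_F=\{\{sr^i,sr^{i+t}\}: i\in\mathbb{Z}_n,\ t\in T\}$ are the copies of $E(\mathrm{Cay}(\mathbb{Z}_n,T))$ on $R_n$ and on $F_n$ respectively. In particular, $\Gamma$ is obtained by taking two identical circulant layers $\mathrm{Cay}(\mathbb{Z}_n,T)$ (on $R_n$ and on $F_n$) and adding the two perfect matchings $M_{b_1},M_{b_2}$ between $R_n$ and $F_n$.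
   Context: $D_{2n}=\langle r,s\mid r^n=e,\ s^2=e,\ srs=r^{-1}\rangle$ is the dihedral group of order $2n$; $R_n=\{r^i:i\in\mathbb{Z}_n\}$ is the set of rotations and $F_n=\{sr^i:i\in\mathbb{Z}_n\}$ the set of reflections; exponents are taken modulo $n$. For a group $G$ and an inverse-closed subset $S\subseteq G\setminus\{e\}$, the undirected Cayley graph $\mathrm{Cay}(G,S)$ has vertex set $G$, with $g,h$ adjacent if and only if $g^{-1}h\in S$ (so the edges are the pairs $\{g,gx\}$ with $g\in G$, $x\in S$). A perfect matching between $R_n$ and $F_n$ is a set of pairs $\{x,y\}$ with $x\in R_n$, $y\in F_n$ such that every element of $R_n\cup F_n$ lies in exactly one pair. *)

(* Defs.v *)
From mathcomp Require Import all_boot all_algebra all_fingroup all_solvable.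

Set Implicit Arguments.
Unset Strict Implicit.
Unset Printing Implicit Defensive.

Import GroupScope.

(* For n > 0 this is the additive group of integers modulo n, including n = 1
   (which the library notation 'Z_n replaces by the integers modulo 2).  It also
   carries the finGroupType structure whose product is addition. *)
Notation ZMod n := 'I_n.-1.+1 (only parsing).

Record graph (T : finType) := Graph { vset : {set T}; eset : {set {set T}} }.

Definition connection_set (gT : finGroupType) (G S : {set gT}) : Prop :=
  [/\ S \subset G, 1 \notin S & {in S, forall x, x^-1 \in S}].

Definition Cay (gT : finGroupType) (G S : {set gT}) : graph gT :=
  Graph G [set [set g; h] | g in G, h in G & g^-1 * h \in S].

Definition graph_union (T : finType) (A B : graph T) : graph T :=
  Graph (vset A :|: vset B) (eset A :|: eset B).

Definition add_edges (T : finType) (A : graph T) (M : {set {set T}}) : graph T :=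
  Graph (vset A) (eset A :|: M).

(* B is the copy of A transported along the injective relabelling f. *)
Definition copy_via (T U : finType) (f : T -> U) (A : graph T) (B : graph U) : Prop :=
  [/\ injective f, vset B = f @: vset A
    & eset B = [set f @: e | e : {set T} in eset A]].

Definition perfect_matching (T : finType) (A B : {set T}) (M : {set {set T}}) : Prop :=
  (forall e, e \in M -> exists x y, [/\ x \in A, y \in B & e = [set x; y]])
  /\ (forall z, z \in A :|: B -> exists! e, e \in M /\ z \in e).

(* G is the dihedral group of order 2n (n > 0), with r and s the two generators
   of its presentation.  The first conjunct determines G up to isomorphism, and
   generators satisfying the relations are the images of the presentation's
   generators under an isomorphism. *)
Definition is_dihedral (n : nat) (gT : finGroupType) (G : {group gT}) (r s : gT) : Prop :=
  [/\ G \isog Grp (x : y : x ^+ n, y ^+ 2, y * x * y = x^-1),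
      <<[set r; s]>> = G, r ^+ n = 1, s ^+ 2 = 1 & s * r * s = r^-1].

Lemma is_dihedral_exists (n : nat) : 1 < n ->
  exists r s : 'D_(n.*2), is_dihedral n [set: 'D_(n.*2)]%G r s.
Proof.
move=> n_gt1.
have D_pres : [set: 'D_(n.*2)] \isog Grp (x : y : x ^+ n, y ^+ 2, y * x * y = x^-1).
  move=> rT H; rewrite (Grp_dihedral n_gt1).
  apply: eq_existsb => -[x y] /=; rewrite !xpair_eqE.
  congr (_ && _); apply: andb_id2l => _; apply: andb_id2l => /eqP y2.
  by rewrite conjgE -(mulg1 y^-1) -y2 expgS expg1 mulKg mulgA.
have := homg_refl [set: 'D_(n.*2)]; rewrite D_pres.
case/existsP=> -[x y] /=; rewrite !xpair_eqE => /and4P[gen /eqP xn /eqP y2 /eqP yxy].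
exists x, y; split=> //.
by rewrite /= -(eqP gen) joing_idl joing_idr.
Qed.

Section Dihedral.

Variables (n : nat) (gT : finGroupType) (r s : gT).

Definition dihedral_rotations : {set gT} := [set r ^+ i | i : ZMod n].

Definition dihedral_reflections : {set gT} := [set s * r ^+ i | i : ZMod n].

Definition rotation_edges (T : {set ZMod n}) : {set {set gT}} :=
  [set [set r ^+ i; r ^+ (i + t)%R] | i : ZMod n, t : ZMod n in T].

Definition reflection_edges (T : {set ZMod n}) : {set {set gT}} :=
  [set [set s * r ^+ i; s * r ^+ (i + t)%R] | i : ZMod n, t : ZMod n in T].

Definition cross_edges (b : ZMod n) : {set {set gT}} :=
  [set [set r ^+ i; s * r ^+ (b - i)%R] | i : ZMod n].

End Dihedral.

(* Main.v *)
Require Import Defs.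
From mathcomp Require Import all_boot all_algebra all_fingroup all_solvable.
Set Implicit Arguments.
Unset Strict Implicit.
Unset Printing Implicit Defensive.
Import GroupScope.

(** The presentation forces [G] to have [2n] elements, while the relations alone
    show that every element of [G] has one of the [2n] forms [r ^ i], [s * r ^ i]
    with [i] in [Z_n].  Hence no two of these forms coincide
    ([dihedral_normal_form]): the two layers are disjoint faithful copies of [Z_n],
    and this is the only place where the presentation, rather than the relations,
    matters.

    An edge of a Cayley graph is a pair [{g, g * x}] with [x] in the connection
    set ([mem_Cay_edges]), so the edges are found by multiplying both forms of [g]
    by each of the four generators, using [r ^ i * s = s * r ^ (- i)]:
    - [r ^ i * r ^ t = r ^ (i + t)] and [(s * r ^ i) * r ^ t = s * r ^ (i + t)]
      stay inside a layer and translate the exponent, as in the circulant graph;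
    - [r ^ i * (s * r ^ b) = s * r ^ (b - i)] and
      [(s * r ^ i) * (s * r ^ b) = r ^ (b - i)] swap the layers, and both
      describe the matching attached to [b], since [i |-> b - i] is an
      involution. *)

(** * Exponents modulo n *)

Lemma expgZD (n : nat) (gT : finGroupType) (r : gT) (i j : ZMod n) :
  0 < n -> r ^+ n = 1 -> r ^+ (i + j)%R = r ^+ i * r ^+ j.
Proof. by case: n i j => // m i j _ rn; rewrite /= expg_mod // expgD. Qed.

Lemma expgZN (n : nat) (gT : finGroupType) (r : gT) (i : ZMod n) :
  0 < n -> r ^+ n = 1 -> r ^+ (- i)%R = (r ^+ i)^-1.
Proof.
move=> n_gt0 rn; apply/eqP; rewrite eq_sym eq_invg_mul -expgZD //.
by rewrite GRing.addrN.
Qed.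

Lemma expgZ_mod (n : nat) (gT : finGroupType) (r : gT) (k : nat) :
  0 < n -> r ^+ n = 1 -> r ^+ (inZp k : ZMod n) = r ^+ k.
Proof. by case: n => // m _ rn; rewrite /= expg_mod. Qed.

(** * Edges of Cayley graphs and matchings *)

Lemma mem_Cay_edges (gT : finGroupType) (G : {group gT}) (S : {set gT})
    (e : {set gT}) : S \subset G ->
  reflect (exists g x, [/\ g \in G, x \in S & e = [set g; g * x]])
          (e \in eset (Cay G S)).
Proof.
move=> /subsetP sSG; apply: (iffP imset2P) => [[g h gG]|[g [x [gG xS ->]]]].
  by rewrite inE => /andP[hG ghS ->]; exists g, (g^-1 * h); rewrite mulKVg.
by exists g (g * x); rewrite // inE mulKg xS groupM // sSG.
Qed.

(** Injectivity and disjointness make the index [i] recoverable from either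
    endpoint of [{f i, g i}], which is what uniqueness of the edge means. *)
Lemma perfect_matching_imset (I T : finType) (f g : I -> T) :
    injective f -> injective g -> (forall i j, f i <> g j) ->
  perfect_matching [set f i | i : I] [set g i | i : I]
                   [set [set f i; g i] | i : I].
Proof.
move=> f_inj g_inj fDg; split=> [e /imsetP[i _ ->]|z].
  by exists (f i), (g i); rewrite !imset_f.
have edge i : [set f i; g i] \in [set [set f i; g i] | i : I] by apply: imset_f.
case/setUP=> /imsetP[i _ ->]; exists [set f i; g i].
  split=> [|e [/imsetP[j _ ->]]]; first by rewrite edge set21.
  by case/set2P=> [/f_inj -> | /fDg].
split=> [|e [/imsetP[j _ ->]]]; first by rewrite edge set22.
by case/set2P=> [/esym/fDg | /g_inj ->].
Qed.

(** An injective relabelling of the vertices carries the circulant graph onto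
    any family of pairs indexed in the same way by a vertex and a step. *)
Lemma copy_via_circulant (n : nat) (U : finType) (f : ZMod n -> U)
    (T : {set ZMod n}) : injective f ->
  copy_via f (Cay [set: ZMod n] T)
    (Graph [set f i | i : ZMod n]
           [set [set f i; f (i + t)%R] | i : ZMod n, t : ZMod n in T]).
Proof.
move=> f_inj; have sTZ : T \subset [set: ZMod n]%G by apply: subsetT.
split=> //=; first by apply/setP=> y; apply/imsetP/imsetP=> -[i _ ->]; exists i;
  rewrite ?inE.
apply/setP=> e; apply/imset2P/imsetP => [[i t _ tT ->]|[e' + ->]].
  exists [set i; (i + t)%R]; last by rewrite imsetU1 imset_set1.
  by apply/(mem_Cay_edges _ sTZ); exists i, t; rewrite inE.
case/(mem_Cay_edges _ sTZ)=> i [t [_ tT ->]].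
by exists i t; rewrite // imsetU1 imset_set1.
Qed.

(** * The dihedral group *)

Section Dihedral.

Variables (n : nat) (gT : finGroupType) (G : {group gT}) (r s : gT).
Hypotheses (n_gt0 : 0 < n) (dihG : is_dihedral n G r s).

Let rn : r ^+ n = 1. Proof. by case: dihG. Qed.
Let ss : s * s = 1. Proof. by case: dihG. Qed.
Let sV : s^-1 = s. Proof. by apply/eqP; rewrite eq_invg_mul ss. Qed.

Lemma rot_mul_refl (i : ZMod n) : r ^+ i * s = s * r ^+ (- i)%R.
Proof.
have rs : r ^ s = r^-1 by rewrite conjgE sV mulgA; case: dihG.
by rewrite conjgC conjXg rs expgVn expgZN.
Qed.

Lemma mem_dihedral (i : ZMod n) : (r ^+ i \in G) * (s * r ^+ i \in G).
Proof.
have [_ genG _ _ _] := dihG.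
have [rG sG] : r \in G /\ s \in G by rewrite -genG !mem_gen ?set21 ?set22.
by rewrite groupM ?groupX.
Qed.

(** The relation [s * r * s = r^-1] makes [s] normalise [<[r]>], so the group they
    generate is the product [<[s]> * <[r]>]. *)
Lemma dihedral_vertices : G :=: dihedral_rotations n r :|: dihedral_reflections n r s.
Proof.
have [_ genG _ _ srs] := dihG.
have rotE x : (x \in dihedral_rotations n r) = (x \in <[r]>).
  apply/imsetP/cycleP => [[i _ ->]|[k ->]]; first by exists i.
  by exists (inZp k); rewrite ?expgZ_mod.
have nrs : <[s]> \subset 'N(<[r]>).
  rewrite cycle_subG inE -cycleJ conjgE sV mulgA srs.
  by rewrite cycle_subG groupV cycle_id.
have defG : G :=: <[s]> * <[r]>.
  by rewrite -norm_joinEl // -genG joingC joing_idl joing_idr.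
apply/setP=> x; apply/idP/setUP; last first.
  by case=> /imsetP[i _ ->]; rewrite mem_dihedral.
rewrite defG => /mulsgP[_ y /cycleP[k ->] ry ->].
rewrite -(odd_double_half k) expgD -mul2n expgM expgS expg1 ss expg1n mulg1.
case: (odd k); [right | left]; last by rewrite expg0 mul1g rotE.
have: y \in dihedral_rotations n r by rewrite rotE.
by case/imsetP=> i _ ->; rewrite expg1; apply/imsetP; exists i.
Qed.

(** Two groups with the same presentation are homomorphic images of each other. *)
Lemma card_is_dihedral : 1 < n -> #|G| = n.*2.
Proof.
move=> n_gt1; have [presG _ _ _ _] := dihG.
have [r' [s' [presD _ _ _ _]]] := is_dihedral_exists n_gt1.
rewrite -(card_dihedral n_gt1); apply: card_isog; rewrite isogEhom.
by rewrite presD -presG homg_refl /= presG -presD homg_refl.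
Qed.

(** [2n] elements are covered by two families of [n], so both families are
    injective and they do not meet. *)
Lemma dihedral_normal_form : 1 < n ->
  [/\ injective (fun i : ZMod n => r ^+ i),
      injective (fun i : ZMod n => s * r ^+ i)
    & [disjoint dihedral_rotations n r & dihedral_reflections n r s]].
Proof.
move=> n_gt1.
have cardZ : #|{: ZMod n}| = n by rewrite card_ord prednK.
have leZ (f : ZMod n -> gT) : #|[set f i | i : ZMod n]| <= n.
  by rewrite -[X in _ <= X]cardZ (leq_trans (leq_imset_card _ _)) ?max_card.
have injZ (f : ZMod n -> gT) : n <= #|[set f i | i : ZMod n]| -> injective f.
  move=> le_n; suff f_inj : {in ZMod n &, injective f} by move=> i j; apply: f_inj.
  apply/imset_injP.
  rewrite eqn_leq leq_imset_card (leq_trans _ le_n) //.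
  by rewrite -[X in _ <= X]cardZ max_card.
have leR := leZ (fun i => r ^+ i); have leF := leZ (fun i => s * r ^+ i).
have := card_is_dihedral n_gt1; rewrite dihedral_vertices cardsU -addnn.
rewrite -/(dihedral_rotations n r) -/(dihedral_reflections n r s) in leR leF *.
set R := dihedral_rotations n r in leR *.
set F := dihedral_reflections n r s in leF *; set c := #|R :&: F| => cardRF.
have lec : c <= #|R| + #|F|.
  by rewrite (leq_trans (subset_leq_card (subsetIl R F))) ?leq_addr.
have sumE : #|R| + #|F| = n + n + c by rewrite -cardRF subnK.
split.
- apply: injZ; rewrite -/R.
  by rewrite -(leq_add2r n) (leq_trans _ (leq_add (leqnn _) leF)) // sumE leq_addr.
- apply: injZ; rewrite -/F.
  by rewrite -(leq_add2l n) (leq_trans _ (leq_add leR (leqnn _))) // sumE leq_addr.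
rewrite -setI_eq0 -cards_eq0 -/c -leqn0 -(leq_add2l (n + n)) -sumE addn0.
exact: leq_add.
Qed.

Lemma rot_neq_refl (i j : ZMod n) : 1 < n -> r ^+ i <> s * r ^+ j.
Proof.
move=> n_gt1 eq_ij; have [_ _ RF0] := dihedral_normal_form n_gt1.
have := disjointFr RF0 (imset_f (fun k : ZMod n => r ^+ k) (isT : i \in ZMod n)).
by rewrite eq_ij => /negP[]; apply: imset_f.
Qed.

(** The map [i |-> b - i] permutes [Z_n], so the second endpoints of the pairs
    [{r ^ i, s * r ^ (b - i)}] run through all reflections once. *)
Lemma cross_edges_perfect_matching (b : ZMod n) : 1 < n ->
  perfect_matching (dihedral_rotations n r) (dihedral_reflections n r s)
                   (cross_edges r s b).
Proof.
move=> n_gt1; have [r_inj sr_inj RF0] := dihedral_normal_form n_gt1.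
have subK (i : ZMod n) : (b - (b - i))%R = i by rewrite GRing.subKr.
have -> : dihedral_reflections n r s = [set s * r ^+ (b - i)%R | i : ZMod n].
  apply/setP=> y; apply/imsetP/imsetP=> -[i _ ->]; exists (b - i)%R => //.
  by rewrite subK.
apply: perfect_matching_imset => // [i j /sr_inj eq_ij | i j eq_ij].
  by rewrite -(subK i) eq_ij subK.
exact: rot_neq_refl eq_ij.
Qed.

Definition dihedral_connection (a b1 b2 : ZMod n) : {set gT} :=
  [set r ^+ a; r ^+ (- a)%R; s * r ^+ b1; s * r ^+ b2].

Lemma dihedral_connectionP (a b1 b2 : ZMod n) (x : gT) :
  reflect ((exists2 t : ZMod n, t \in [set a; (- a)%R] & x = r ^+ t)
           \/ (exists2 b : ZMod n, b \in [set b1; b2] & x = s * r ^+ b))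
          (x \in dihedral_connection a b1 b2).
Proof.
rewrite !inE -!orbA; apply: (iffP or4P) => [|[[t + ->]|[b + ->]]].
- case=> /eqP->; [left; exists a | left; exists (- a)%R
    | right; exists b1 | right; exists b2]; by rewrite ?set21 ?set22.
- by case/set2P=> ->; [apply: Or41 | apply: Or42].
- by case/set2P=> ->; [apply: Or43 | apply: Or44].
Qed.

Lemma dihedral_connection_set (a b1 b2 : ZMod n) : 1 < n -> a <> 0%R ->
  connection_set G (dihedral_connection a b1 b2).
Proof.
move=> n_gt1 a_neq0; have [r_inj _ _] := dihedral_normal_form n_gt1.
split=> [||x].
- by apply/subsetP=> x /dihedral_connectionP[] [i _ ->]; rewrite mem_dihedral.
- have r0 : 1 = r ^+ (0 : ZMod n)%R by [].
  apply/negP=> /dihedral_connectionP[] [i]; rewrite r0; last first.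
    by move=> _ /rot_neq_refl -/(_ n_gt1).
  move=> + /r_inj i0; rewrite -i0 !inE => /orP[/eqP/esym //|].
  by rewrite eq_sym GRing.oppr_eq0 => /eqP.
case/dihedral_connectionP=> [] [i iS ->]; apply/dihedral_connectionP.
  left; exists (- i)%R; last by rewrite expgZN.
  by case/set2P: iS => ->; rewrite ?GRing.opprK ?set21 ?set22.
right; exists i => //; apply/eqP.
by rewrite eq_invg_mul mulgA -(mulgA s) rot_mul_refl mulgA ss mul1g -expgZD ?GRing.addNr.
Qed.

(** A vertex in either layer and a generator of either kind give four families
    of edges.  The two families crossing between the layers are the same one,
    read from its two ends. *)
Lemma dihedral_Cay_edges (a b1 b2 : ZMod n) :
  eset (Cay G (dihedral_connection a b1 b2)) =
  rotation_edges r [set a; (- a)%R] :|: reflection_edges r s [set a; (- a)%R]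
    :|: cross_edges r s b1 :|: cross_edges r s b2.
Proof.
have sSG : dihedral_connection a b1 b2 \subset G.
  by apply/subsetP=> x /dihedral_connectionP[] [i _ ->]; rewrite mem_dihedral.
have crossP (e : {set gT}) :
    reflect (exists2 b, b \in [set b1; b2] & e \in cross_edges r s b)
            (e \in cross_edges r s b1 :|: cross_edges r s b2).
  apply: (iffP setUP) => [[]|[b /set2P[]->]]; [| | by left | by right].
    by exists b1; rewrite ?set21.
  by exists b2; rewrite ?set22.
have rot_cross (i b : ZMod n) : r ^+ i * (s * r ^+ b) = s * r ^+ (b - i)%R.
  by rewrite mulgA rot_mul_refl -mulgA -expgZD // GRing.addrC.
have refl_cross (i b : ZMod n) : s * r ^+ i * (s * r ^+ b) = r ^+ (b - i)%R.
  by rewrite -mulgA rot_cross mulgA ss mul1g.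
apply/setP=> e; rewrite -setUA; apply/(mem_Cay_edges _ sSG)/setUP; last first.
  case=> [/setUP[] /imset2P[i t _ tT ->] | /crossP[b bB /imsetP[i _ ->]]].
  - exists (r ^+ i), (r ^+ t); rewrite mem_dihedral -expgZD //.
    by split=> //; apply/dihedral_connectionP; left; exists t.
  - exists (s * r ^+ i), (r ^+ t); rewrite mem_dihedral -mulgA -expgZD //.
    by split=> //; apply/dihedral_connectionP; left; exists t.
  exists (r ^+ i), (s * r ^+ b); rewrite mem_dihedral rot_cross.
  by split=> //; apply/dihedral_connectionP; right; exists b.
case=> g [x [+ /dihedral_connectionP xS ->]].
rewrite dihedral_vertices => /setUP[] /imsetP[i _ ->].
  case: xS => [[t tT ->]|[b bB ->]].
    by left; apply/setUP; left; rewrite -expgZD //; apply/imset2P; exists i t.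
  right; apply/crossP; exists b; rewrite // rot_cross.
  by apply/imsetP; exists i.
case: xS => [[t tT ->]|[b bB ->]].
  left; apply/setUP; right; rewrite -mulgA -expgZD //.
  by apply/imset2P; exists i t.
right; apply/crossP; exists b; rewrite // refl_cross setUC.
by apply/imsetP; exists (b - i)%R; rewrite // GRing.subKr.
Qed.

End Dihedral.

Theorem proposition5p1 (n : nat) (gT : finGroupType) (G : {group gT}) (r s : gT)
  (a b1 b2 : ZMod n) (n_gt0 : 0 < n) (dihG : is_dihedral n G r s)
  (a_neq0 : a <> 0%R) (a_neq_half : ~~ odd n -> (a : nat) <> n./2) :
  let S := [set r ^+ a; r ^+ (- a)%R; s * r ^+ b1; s * r ^+ b2] in
  let T := [set a; (- a)%R] in
  let R := dihedral_rotations n r in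
  let F := dihedral_reflections n r s in
  let E_R := rotation_edges r T in
  let E_F := reflection_edges r s T in
  let M1 := cross_edges r s b1 in
  let M2 := cross_edges r s b2 in
  let circulant := Cay [set: ZMod n] T in
  let Gamma := Cay G S in
  [/\ connection_set G S, connection_set [set: ZMod n] T,
      vset Gamma = R :|: F & eset Gamma = E_R :|: E_F :|: M1 :|: M2]
  /\ [/\ copy_via (fun i : ZMod n => r ^+ i) circulant (Graph R E_R),
         copy_via (fun i : ZMod n => s * r ^+ i) circulant (Graph F E_F),
         [disjoint R & F],
         perfect_matching R F M1 /\ perfect_matching R F M2
       & Gamma = add_edges (add_edges (graph_union (Graph R E_R) (Graph F E_F)) M1) M2].
Proof.
move=> S T R F E_R E_F M1 M2 circulant Gamma.
have n_gt1 : 1 < n.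
  rewrite ltn_neqAle n_gt0 andbT; apply/eqP=> n1; case: a_neq0.
  by apply: val_inj; case: (a) => k /=; rewrite -n1 ltnS leqn0 => /eqP.
have [r_inj sr_inj RF0] := dihedral_normal_form n_gt0 dihG n_gt1.
have V_Gamma : vset Gamma = R :|: F by apply: dihedral_vertices.
have E_Gamma : eset Gamma = E_R :|: E_F :|: M1 :|: M2 by apply: dihedral_Cay_edges.
have T_conn : connection_set [set: ZMod n] T.
  split=> [||t /set2P[]->]; first exact: subsetT.
  - apply/negP=> /set2P[/esym //|/esym/eqP Na_eq0].
    by case: a_neq0; apply/eqP; rewrite -GRing.oppr_eq0.
  - exact: set22.
  - by rewrite [_^-1]GRing.opprK set21.
split; split=> //.
- exact: dihedral_connection_set.
- exact: copy_via_circulant.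
- exact: copy_via_circulant.
- by split; apply: (cross_edges_perfect_matching n_gt0 dihG).
by rewrite /add_edges /graph_union /= -V_Gamma -E_Gamma.
Qed.
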